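(* Let $r\geq2$ and $n\geq1$ be integers, and let the group $C_r:=\langle e^{2\pi i/r}\rangle$ of $r$th roots of unity act on $\mathbb C^n$ by scalar multiplication. Define $\phi\colon\mathbb C^n\to(\mathbb C^n)^{\otimes2}$ and $\psi\colon\mathbb C^n\to(\mathbb C^n)^{\otimes r}$ by $$\phi(u)=\frac{u\otimes\overline u}{\|u\|},\qquad\psi(u)=\frac{u^{\otimes r}}{\|u\|^{r-1}}\qquad(u\ne0),\qquad\phi(0)=0,\ \psi(0)=0,$$ and define $F\colon\mathbb C^n/C_r\to(\mathbb C^n)^{\otimes2}\times(\mathbb C^n)^{\otimes r}$ by $$F([u])=\big(\cos(\tfrac{\pi}{2r})\,\phi(u),\ \sin(\tfrac{\pi}{2r})\,\psi(u)\big).$$ Then for all $u,v\in\mathbb C^n$, $$d_{C_r}([u],[v])\leq\|F([u])-F([v])\|\leq r\sin(\tfrac{\pi}{2r})\cdot d_{C_r}([u],[v]).$$ In particular, $c_2(\mathbb C^n/C_r)=\kappa(F)=r\sin(\tfrac{\pi}{2r})$.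
   Context: $d_{C_r}$ is the quotient metric $d_{C_r}([u],[v])=\min_{\zeta\in C_r}\|u-\zeta v\|$ on $\mathbb C^n/C_r$, where $[u]=C_r\cdot u$. Tensor powers of $\mathbb C^n$ carry the standard Hilbert space structure with $\langle x_1\otimes\cdots\otimes x_k,y_1\otimes\cdots\otimes y_k\rangle=\prod_i\langle x_i,y_i\rangle$, and products of Hilbert spaces carry the product Hilbert norm. For a map $f\colon X\to Y$ of metric spaces, let $\alpha,\beta\in[0,\infty]$ be the largest and smallest constants (respectively) with $\alpha\, d_X(x,x')\le d_Y(f(x),f(x'))\le\beta\, d_X(x,x')$ for all $x,x'\in X$; the distortion of $f$ is $\kappa(f):=\beta/\alpha$, with $\kappa(f)=\infty$ if $\alpha=0$ or $\beta=\infty$. The Euclidean distortion $c_2(X)\in[1,\infty]$ is the infimum of all $c$ for which there exist a Hilbert space $H$ and a map $f\colon X\to H$ with $\kappa(f)=c$. *)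

(* Defs.v *)
From HB Require Import structures.
From mathcomp Require Import all_boot all_order all_algebra.
From mathcomp Require Import all_classical all_reals all_analysis.
From mathcomp Require Import complex.
From mathcomp Require Import ring lra.

Set Implicit Arguments.
Unset Strict Implicit.
Unset Printing Implicit Defensive.

Import Order.TTheory GRing.Theory Num.Theory.
Import numFieldNormedType.Exports.

Local Open Scope classical_set_scope.
Local Open Scope ring_scope.
Local Open Scope quotient_scope.

(* Hilbert spaces are taken over the reals; a complex Hilbert space enters
   through the real inner product [Re <x, y>], which has the same norm. *)
HB.mixin Record NormedModule_hasInner (R : realType) H
    & NormedModule R H & Metric R H := {
  inner : H -> H -> R ;
  innerC : forall x y, inner x y = inner y x ;
  inner_linearl : forall a x y z,
    inner (a *: x + y) z = a * inner x z + inner y z ;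
  inner_norm : forall x, inner x x = `|x| ^+ 2 ;
  mdist_normB : forall x y : H, mdist x y = `|x - y|
}.

#[short(type="preHilbertType")]
HB.structure Definition PreHilbert (R : realType) :=
  {H of NormedModule R H & Metric R H & NormedModule_hasInner R H}.

#[short(type="hilbertType")]
HB.structure Definition Hilbert (R : realType) :=
  {H of CompleteNormedModule R H & Metric R H & NormedModule_hasInner R H}.

HB.factory Record Lmodule_isPreHilbert (R : realType) V & GRing.Lmodule R V := {
  inner : V -> V -> R ;
  innerC : forall x y, inner x y = inner y x ;
  inner_linearl : forall a x y z,
    inner (a *: x + y) z = a * inner x z + inner y z ;
  inner_ge0 : forall x, 0 <= inner x x ;
  inner_eq0 : forall x, inner x x = 0 -> x = 0
}.

HB.builders Context R V & Lmodule_isPreHilbert R V.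

Let norm x := Num.sqrt (inner x x).

Let innerDl x y z : inner (x + y) z = inner x z + inner y z.
Proof. by have := inner_linearl 1 x y z; rewrite scale1r mul1r. Qed.

Let inner0l z : inner 0 z = 0.
Proof. by have := innerDl 0 0 z; rewrite addr0; lra. Qed.

Let innerZl a x z : inner (a *: x) z = a * inner x z.
Proof. by have := inner_linearl a x 0 z; rewrite addr0 inner0l addr0. Qed.

Let innerDr x y z : inner z (x + y) = inner z x + inner z y.
Proof. by rewrite innerC innerDl ![inner z _]innerC. Qed.

Let innerZr a x z : inner z (a *: x) = a * inner z x.
Proof. by rewrite innerC innerZl [inner z _]innerC. Qed.

Let norm_sqr x : norm x ^+ 2 = inner x x.
Proof. by rewrite sqr_sqrtr// inner_ge0. Qed.

Let CS x y : inner x y <= norm x * norm y.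
Proof.
have nx : 0 <= norm x := sqrtr_ge0 _.
have ny : 0 <= norm y := sqrtr_ge0 _.
have [y0|yn0] := eqVneq (inner y y) 0.
  have -> : y = 0 by exact: inner_eq0.
  by rewrite innerC inner0l mulr_ge0// sqrtr_ge0.
have ygt0 : 0 < inner y y by rewrite lt_neqAle eq_sym yn0 inner_ge0.
have H := inner_ge0 (inner y y *: x + (- inner x y) *: y).
rewrite !(innerDl, innerDr, innerZl, innerZr) [inner y x]innerC in H.
have {}H : 0 <= inner y y * (inner x x * inner y y - inner x y ^+ 2).
  by apply: le_trans H _; rewrite le_eqVlt; apply/orP; left; apply/eqP; ring.
rewrite pmulr_rge0// subr_ge0 -!norm_sqr -exprMn in H.
have [xy|/ltW xy] := leP 0 (inner x y); last exact: le_trans xy (mulr_ge0 _ _).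
by rewrite -ler_sqr ?nnegrE// mulr_ge0.
Qed.

Let ler_normD x y : norm (x + y) <= norm x + norm y.
Proof.
rewrite -ler_sqr ?nnegrE ?addr_ge0 ?sqrtr_ge0// norm_sqr sqrrD !norm_sqr.
rewrite innerDl !innerDr [inner y x]innerC; have := CS x y.
by rewrite mulr2n; lra.
Qed.

Let normrZ (l : R) x : norm (l *: x) = `|l| * norm x.
Proof.
by rewrite /norm innerZl innerZr mulrA -expr2 sqrtrM ?sqr_ge0// sqrtr_sqr.
Qed.

Let normr0_eq0 x : norm x = 0 -> x = 0.
Proof.
move=> /eqP; rewrite sqrtr_eq0 => x0; apply: inner_eq0.
by apply: le_anti; rewrite x0 inner_ge0.
Qed.

HB.instance Definition _ :=
  Lmodule_isNormed.Build R V ler_normD normrZ normr0_eq0.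

Let mdist (x y : V) : R := `|x - y|.

Let mdist_ge0 x y : 0 <= mdist x y. Proof. exact: normr_ge0. Qed.

Let mdist_positivity x y : mdist x y = 0 -> x = y.
Proof. by move/normr0_eq0/eqP; rewrite subr_eq0 => /eqP. Qed.

Let ballEmdist x d : ball x d = [set y | mdist x y < d].
Proof. by rewrite -ball_normE. Qed.

HB.instance Definition _ := PseudoMetric_isMetric.Build R V
  mdist_ge0 mdist_positivity ballEmdist.

Let inner_norm x : inner x x = `|x| ^+ 2.
Proof. by rewrite -norm_sqr. Qed.

Let mdist_normB (x y : V) : mdist x y = `|x - y|. Proof. by []. Qed.

HB.instance Definition _ := NormedModule_hasInner.Build R V
  innerC inner_linearl inner_norm mdist_normB.

HB.end.

Section Complete.
Variable R : realType.

Lemma lip_cauchy (V W : normedModType R) (p : V -> W) (F : set_system V) :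
  Filter F -> (forall x y, `|p x - p y| <= `|x - y|) ->
  cauchy F -> cauchy (p @ F).
Proof.
move=> FF lip /cauchy_ballP cF; apply/cauchy_ballP => e e0.
have [[A B] /= [FA FB] AB] := cF _ e0.
exists (p @` A, p @` B) => /=.
  by split; [apply: filterS FA | apply: filterS FB] => x /=; exists x.
move=> [_ _] /= [[a Aa <-] [b Bb <-]].
have := AB (a, b) (conj Aa Bb); rewrite -!ball_normE /=.
exact: le_lt_trans.
Qed.

End Complete.

(* [C^I] in the standard basis. [*:] is scaling by reals only; complex scaling
   is [cscale] below. *)
Definition Cspace (R : realType) (I : finType) := {ffun I -> R[i]}.

Section CspaceLmodule.
Variables (R : realType) (I : finType).
Local Notation V := (Cspace R I).

HB.instance Definition _ := GRing.Zmodule.copy V {ffun I -> R[i]}.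

Definition cscale (z : R[i]) (x : V) : V := [ffun i => z * x i].

Let rscale (a : R) (x : V) : V := cscale a%:C%C x.

Let rscaleA a b x : rscale a (rscale b x) = rscale (a * b) x.
Proof. by apply/ffunP => i; rewrite !ffunE mulrA -rmorphM. Qed.
Let rscale1 : left_id 1 rscale.
Proof. by move=> x; apply/ffunP => i; rewrite !ffunE mul1r. Qed.
Let rscaleDr : right_distributive rscale +%R.
Proof. by move=> a x y; apply/ffunP => i; rewrite !ffunE mulrDr. Qed.
Let rscaleDl x : {morph rscale^~ x : a b / a + b}.
Proof. by move=> a b; apply/ffunP => i; rewrite !ffunE rmorphD/= mulrDl. Qed.

HB.instance Definition _ :=
  GRing.Zmodule_isLmodule.Build R V rscaleA rscale1 rscaleDr rscaleDl.

Lemma rscaleE (a : R) (x : V) : a *: x = cscale a%:C%C x.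
Proof. by []. Qed.

Definition cdot (x y : V) : R[i] := \sum_i x i * (y i)^*%C.

Let rdot (x y : V) : R := complex.Re (cdot x y).

Lemma Re_cdot x y : complex.Re (cdot x y) =
  \sum_i (complex.Re (x i) * complex.Re (y i) +
          complex.Im (x i) * complex.Im (y i)).
Proof.
rewrite /cdot; elim/big_rec2: _ => // i a b _ <-.
by case: (x i) (y i) b => [p q] [s t] [b1 b2] /=; rewrite mulrN opprK.
Qed.

Let rdotC x y : rdot x y = rdot y x.
Proof.
by rewrite /rdot !Re_cdot; apply: eq_bigr => i _; rewrite mulrC [X in _ + X]mulrC.
Qed.

Let rdot_linearl a x y z : rdot (a *: x + y) z = a * rdot x z + rdot y z.
Proof.
rewrite /rdot !Re_cdot big_distrr -big_split /=; apply: eq_bigr => i _.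
rewrite !ffunE; case: (x i) (y i) (z i) => [p q] [s t] [b1 b2] /=; ring.
Qed.

Let rdot_ge0 x : 0 <= rdot x x.
Proof.
by rewrite /rdot Re_cdot sumr_ge0// => i _; rewrite -!expr2 addr_ge0 ?sqr_ge0.
Qed.

Let rdot_eq0 x : rdot x x = 0 -> x = 0.
Proof.
rewrite /rdot Re_cdot => /eqP; rewrite psumr_eq0 => [/allP x0|i _]; last first.
  by rewrite -!expr2 addr_ge0 ?sqr_ge0.
apply/ffunP => i; rewrite !ffunE; have := x0 i (mem_index_enum _).
rewrite -!expr2 paddr_eq0 ?sqr_ge0// !sqrf_eq0.
by case: (x i) => [a b] /= /andP[/eqP-> /eqP->].
Qed.

HB.instance Definition _ := Lmodule_isPreHilbert.Build R V
  rdotC rdot_linearl rdot_ge0 rdot_eq0.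

Lemma Cspace_innerE (x y : V) : inner x y = complex.Re (cdot x y).
Proof. by []. Qed.

Lemma Cspace_normE (x : V) :
  `|x| ^+ 2 = \sum_i (complex.Re (x i) ^+ 2 + complex.Im (x i) ^+ 2).
Proof. by rewrite -inner_norm Cspace_innerE Re_cdot. Qed.

Let coord (b : bool) i (x : V) : R :=
  if b then complex.Re (x i) else complex.Im (x i).

Let coordB b i (x y : V) : coord b i (x - y) = coord b i x - coord b i y.
Proof. by rewrite /coord !ffunE; case: b; case: (x i) (y i) => ? ? []. Qed.

Let coord_le b i (x : V) : `|coord b i x| <= `|x|.
Proof.
rewrite -ler_sqr ?nnegrE// Cspace_normE (bigD1 i)//= real_normK ?num_real//.
apply: (@le_trans _ _ (complex.Re (x i) ^+ 2 + complex.Im (x i) ^+ 2)).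
  by rewrite /coord; case: b; [rewrite lerDl sqr_ge0|rewrite lerDr sqr_ge0].
by rewrite lerDl sumr_ge0// => j _; rewrite addr_ge0 ?sqr_ge0.
Qed.

Let normr_le (x : V) m : 0 <= m -> (forall b i, `|coord b i x| <= m) ->
  `|x| <= (2 * #|I|)%:R * m.
Proof.
move=> m0 xm; rewrite -ler_sqr ?nnegrE ?mulr_ge0// Cspace_normE.
apply: (@le_trans _ _ (\sum_(i : I) 2 * m ^+ 2)).
  apply: ler_sum => i _; rewrite mulr_natl mulr2n.
  by apply: lerD; rewrite -real_normK ?num_real// ler_sqr ?nnegrE//;
    [exact: (xm true i) | exact: (xm false i)].
rewrite sumr_const -[leLHS]mulr_natl mulrA [leRHS]exprMn.
apply: ler_wpM2r; first exact: sqr_ge0.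
rewrite -natrM -natrX ler_nat; case: #|I| => // k.
by rewrite expnMn mulnC leq_mul// -[leqLHS]expn1 leq_pexp2l.
Qed.

Let Cspace_complete (F : set_system V) : ProperFilter F -> cauchy F -> cvg F.
Proof.
move=> FF cF.
have cC b i : cvg (coord b i @ F).
  apply: R_complete; apply: (@lip_cauchy R V R^o) => // x y.
  by rewrite -coordB coord_le.
pose a : V := [ffun i => (lim (coord true i @ F) +i* lim (coord false i @ F))%C].
have ca b i : coord b i @ F --> coord b i a.
  by case: b (cC b i) => h; rewrite /coord ffunE.
apply/cvg_ex; exists a; apply/cvgrPdist_le => e e0.
pose d := e / (2 * #|I|).+1%:R.
have d0 : 0 < d by rewrite divr_gt0.
near=> x.
have H : forall p : bool * I, `|coord p.1 p.2 a - coord p.1 p.2 x| <= d.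
  near: x; apply: filter_forall => p.
  by have /cvgrPdist_le := ca p.1 p.2; apply.
apply: le_trans (normr_le (ltW d0) _) _ => [b i|].
  by rewrite coordB; exact: (H (b, i)).
by rewrite /d mulrCA ler_piMr ?(ltW e0)// ler_pdivrMr// mul1r ler_nat.
Unshelve. all: by end_near. Qed.

HB.instance Definition _ := Uniform_isComplete.Build V Cspace_complete.
End CspaceLmodule.


(* An alias, since [V * W] already carries the max norm. *)
Definition hilbert_prod (R : realType) (V W : hilbertType R) := (V * W)%type.

Section HilbertProd.
Variables (R : realType) (V W : hilbertType R).
Local Notation P := (hilbert_prod V W).

HB.instance Definition _ := GRing.Lmodule.copy P (V * W)%type.

Let pinner (x y : P) : R := inner x.1 y.1 + inner x.2 y.2.

Let pinnerC x y : pinner x y = pinner y x.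
Proof. by rewrite /pinner innerC [inner x.2 _]innerC. Qed.

Let pinner_linearl a x y z : pinner (a *: x + y) z = a * pinner x z + pinner y z.
Proof. by rewrite /pinner /= !inner_linearl mulrDr addrACA. Qed.

Let pinner_ge0 x : 0 <= pinner x x.
Proof. by rewrite /pinner !inner_norm addr_ge0 ?sqr_ge0. Qed.

Let pinner_eq0 x : pinner x x = 0 -> x = 0.
Proof.
case: x => a b /eqP; rewrite /pinner !inner_norm paddr_eq0 ?sqr_ge0//=.
by rewrite !sqrf_eq0 !normr_eq0 => /andP[/eqP-> /eqP->].
Qed.

HB.instance Definition _ := Lmodule_isPreHilbert.Build R P
  pinnerC pinner_linearl pinner_ge0 pinner_eq0.

Lemma hilbert_prod_innerE (x y : P) :
  inner x y = inner x.1 y.1 + inner x.2 y.2.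
Proof. by []. Qed.

Lemma hilbert_prod_normE (x : P) : `|x| ^+ 2 = `|x.1| ^+ 2 + `|x.2| ^+ 2.
Proof. by rewrite -inner_norm hilbert_prod_innerE !inner_norm. Qed.

Let P_complete (F : set_system P) : ProperFilter F -> cauchy F -> cvg F.
Proof.
move=> FF cF.
have c1 : cvg ((fst : P -> V) @ F).
  apply: cauchy_cvg; apply: lip_cauchy cF => x y.
  rewrite -ler_sqr ?nnegrE// hilbert_prod_normE /=.
  by rewrite lerDl sqr_ge0.
have c2 : cvg ((snd : P -> W) @ F).
  apply: cauchy_cvg; apply: lip_cauchy cF => x y.
  rewrite -ler_sqr ?nnegrE// hilbert_prod_normE /=.
  by rewrite lerDr sqr_ge0.
apply/cvg_ex; exists (lim ((fst : P -> V) @ F), lim ((snd : P -> W) @ F)).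
apply/cvgrPdist_le => e e0.
have e20 : 0 < e / 2 by rewrite divr_gt0.
near=> x.
have h1 : `|lim ((fst : P -> V) @ F) - x.1| <= e / 2.
  by near: x; have /cvgrPdist_le := c1; apply.
have h2 : `|lim ((snd : P -> W) @ F) - x.2| <= e / 2.
  by near: x; have /cvgrPdist_le := c2; apply.
rewrite -ler_sqr ?nnegrE ?(ltW e0)// hilbert_prod_normE /=.
have {}h1 := lerXn2r 2 (normr_ge0 _) (ltW e20) h1.
have {}h2 := lerXn2r 2 (normr_ge0 _) (ltW e20) h2.
apply: le_trans (lerD h1 h2) _.
have := sqr_ge0 e; rewrite !expr2; lra.
Unshelve. all: by end_near. Qed.

HB.instance Definition _ := Uniform_isComplete.Build P P_complete.
End HilbertProd.

Section Tensor.
Variables (R : realType) (n : nat).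

(* [(C^n)^{⊗k}] in coordinates: the basis tensor
   [e_(s 0) ⊗ ... ⊗ e_(s (k-1))] is indexed by [s : {ffun 'I_k -> 'I_n}]. *)
Definition tensor_power (k : nat) := Cspace R {ffun 'I_k -> 'I_n}.

HB.instance Definition _ k := Hilbert.on (tensor_power k).

Definition pure_tensor (k : nat) (x : 'I_k -> Cspace R 'I_n) : tensor_power k :=
  [ffun s : {ffun 'I_k -> 'I_n} => \prod_j x j (s j)].

Lemma cdot_pure_tensor k (x y : 'I_k -> Cspace R 'I_n) :
  cdot (pure_tensor x) (pure_tensor y) = \prod_j cdot (x j) (y j).
Proof.
rewrite /cdot bigA_distr_bigA /=; apply: eq_bigr => s _.
by rewrite !ffunE rmorph_prod -big_split.
Qed.

Definition conj_vec (u : Cspace R 'I_n) : Cspace R 'I_n :=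
  [ffun i => (u i)^*%C].

Definition phi (u : Cspace R 'I_n) : tensor_power 2 :=
  if u == 0 then 0
  else `|u|^-1 *: pure_tensor (fun j => if j == ord0 then u else conj_vec u).

Definition psi (r : nat) (u : Cspace R 'I_n) : tensor_power r :=
  if u == 0 then 0 else (`|u| ^+ r.-1)^-1 *: pure_tensor (fun=> u).

End Tensor.

Section RootsOfUnity.
Variables (R : realType) (r : nat).

(* [e^{2 pi i / r}] *)
Definition zeta : R[i] := (cos (2 * pi / r%:R) +i* sin (2 * pi / r%:R))%C.

Definition Crot : set R[i] := [set z | exists k : int, z = zeta ^ k].

Lemma zetaX k : zeta ^+ k =
  (cos (2 * pi / r%:R *+ k) +i* sin (2 * pi / r%:R *+ k))%C.
Proof.
elim: k => [|k IH]; first by rewrite expr0 mulr0n cos0 sin0.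
rewrite exprSr IH [_ *+ k.+1]mulrSr cosD sinD /zeta /=.
by congr (_ +i* _)%C; rewrite addrC [X in X + _]mulrC.
Qed.

Lemma zeta_conj : zeta * zeta^*%C = 1.
Proof.
apply/eqP; rewrite eq_complex /= mulrN opprK -!expr2 cos2Dsin2 eqxx /=.
by rewrite [X in _ + X]mulrC mulrN addNr.
Qed.

Lemma zeta_expr_order : zeta ^+ r = 1.
Proof.
have [->|r0] := eqVneq r 0%N; first exact: expr0.
rewrite zetaX -mulr_natr divfK ?pnatr_eq0//.
rewrite (_ : 2 * pi = pi + pi); last by ring.
by rewrite cosD sinD cospi sinpi; congr (_ +i* _)%C; ring.
Qed.

Lemma zeta_neq0 : zeta != 0.
Proof. by apply: contra_eq_neq zeta_conj => ->; rewrite mul0r eq_sym oner_eq0. Qed.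

Lemma Crot1 : Crot 1. Proof. by exists 0; rewrite expr0z. Qed.

Lemma CrotM z w : Crot z -> Crot w -> Crot (z * w).
Proof. by move=> [k ->] [l ->]; exists (k + l); rewrite expfzDr// zeta_neq0. Qed.

Lemma CrotV z : Crot z -> Crot z^-1.
Proof. by move=> [k ->]; exists (- k); rewrite invr_expz. Qed.

Lemma Crot_conj z : Crot z -> z * z^*%C = 1.
Proof.
move=> [k ->]; rewrite (fmorphXz conjc) -expfzMl.
by rewrite zeta_conj exp1rz.
Qed.

Lemma Crot_expr z : Crot z -> z ^+ r = 1.
Proof.
move=> [k ->]; rewrite exprnP exprzAC -exprnP.
by rewrite zeta_expr_order exp1rz.
Qed.

Lemma Crot_neq0 z : Crot z -> z != 0.
Proof.
by move/Crot_conj => h; apply: contra_eq_neq h => ->; rewrite mul0r eq_sym oner_eq0.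
Qed.

Lemma Crot_finite z : Crot z -> exists k : 'I_r.-1.+1, z = zeta ^+ k.
Proof.
move=> [k ->]; have [r0|r0] := posnP r.
  exists ord0; rewrite expr0 (_ : zeta = 1) ?exp1rz//.
  by rewrite /zeta r0 invr0 mulr0 cos0 sin0.
have rn0 : r%:Z != 0 by rewrite eqz_nat -lt0n.
have m0 : (0 <= k %% r)%Z by rewrite modz_ge0.
have mr : (`|k %% r|%Z < r.-1.+1)%N.
  by rewrite prednK// -ltz_nat gez0_abs// ltz_pmod.
exists (Ordinal mr) => /=.
rewrite exprnP gez0_abs// [in LHS](divz_eq k r) expfzDr ?zeta_neq0//.
by rewrite [(_ %/ _)%Z * _]mulrC -exprz_exp -exprnP zeta_expr_order exp1rz mul1r.
Qed.

End RootsOfUnity.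

Section OrbitSpace.
Variables (R : realType) (n r : nat).
Local Notation V := (Cspace R 'I_n).

Lemma cscaleA z w (u : V) : cscale z (cscale w u) = cscale (z * w) u.
Proof. by apply/ffunP => i; rewrite !ffunE mulrA. Qed.

Lemma cscale1 (u : V) : cscale 1 u = u.
Proof. by apply/ffunP => i; rewrite !ffunE mul1r. Qed.

Lemma cscaleB z (u v : V) : cscale z (u - v) = cscale z u - cscale z v.
Proof. by apply/ffunP => i; rewrite !ffunE mulrBr. Qed.

Lemma norm_cscale_Crot z (u : V) : Crot r z -> `|cscale z u| = `|u|.
Proof.
move=> /Crot_conj zz; apply/eqP; rewrite -(@eqrXn2 _ 2)//.
rewrite -!inner_norm !Cspace_innerE; apply/eqP; congr complex.Re.
apply: eq_bigr => i _; rewrite !ffunE rmorphM/= mulrACA.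
by have -> : z * z^*%C = 1 := zz; rewrite mul1r.
Qed.

(* [same_orbit u v] iff [u] belongs to the orbit [C_r v]. *)
Definition same_orbit (u v : V) : bool :=
  `[< exists2 z, Crot r z & u = cscale z v >].

Lemma same_orbitP u v :
  reflect (exists2 z, Crot r z & u = cscale z v) (same_orbit u v).
Proof. exact: asboolP. Qed.

Lemma same_orbit_refl : reflexive same_orbit.
Proof.
by move=> u; apply/same_orbitP; exists 1; rewrite ?cscale1//; exact: Crot1.
Qed.

Lemma same_orbit_sym : symmetric same_orbit.
Proof.
move=> u v; apply/same_orbitP/same_orbitP => -[z zC ->];
  exists z^-1; rewrite ?cscaleA ?mulVf ?cscale1 ?(Crot_neq0 zC)//; exact: CrotV.
Qed.

Lemma same_orbit_trans : transitive same_orbit.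
Proof.
move=> v u w /same_orbitP[z zC ->] /same_orbitP[t tC ->].
by apply/same_orbitP; exists (z * t); rewrite ?cscaleA//; exact: CrotM.
Qed.

Canonical same_orbit_equiv :=
  EquivRel same_orbit same_orbit_refl same_orbit_sym same_orbit_trans.

(* [C^n / C_r] *)
Definition orbit_space := {eq_quot same_orbit}.

HB.instance Definition _ := Choice.on orbit_space.
HB.instance Definition _ := EqQuotient.on orbit_space.

Definition orbit_class (u : V) : orbit_space := \pi_orbit_space u.

Lemma orbit_eqP u v :
  orbit_class u = orbit_class v <-> exists2 z, Crot r z & u = cscale z v.
Proof.
split=> [/eqP|/same_orbitP h]; last by apply/eqP; rewrite /orbit_class eqmodE.
by rewrite /orbit_class eqmodE => /same_orbitP.
Qed.

Definition rot_dist (u v : V) : R := inf [set `|u - cscale z v| | z in Crot r].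

Let rot_dist_lb (u v : V) :
  has_lbound ([set `|u - cscale z v| | z in @Crot R r] : set R).
Proof. by exists 0 => _ [z _ <-]. Qed.

Lemma rot_dist_le u v z : Crot r z -> rot_dist u v <= `|u - cscale z v|.
Proof. by move=> zC; apply: ge_inf => //; exists z. Qed.

(* The infimum is a minimum. *)
Lemma rot_dist_attained u v :
  exists2 z, Crot r z & rot_dist u v = `|u - cscale z v|.
Proof.
have [k _ kmin] := @arg_minP _ _ 'I_r.-1.+1 ord0 predT
  (fun k : 'I_r.-1.+1 => `|u - cscale (zeta R r ^+ k) v|) isT.
exists (zeta R r ^+ k); first by exists k%:Z.
apply/le_anti/andP; split; first by apply: rot_dist_le; exists k%:Z.
apply: lb_le_inf; first by exists `|u - cscale 1 v|, 1 => //; exact: Crot1.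
by move=> _ [z /Crot_finite[l ->] <-]; exact: kmin.
Qed.

Let rot_dist_scaler u v z : Crot r z -> rot_dist u (cscale z v) = rot_dist u v.
Proof.
suff le w t : Crot r t -> rot_dist u (cscale t w) <= rot_dist u w.
  move=> zC; apply/le_anti; rewrite le//=.
  have := le (cscale z v) z^-1 (CrotV zC).
  by rewrite cscaleA mulVf ?(Crot_neq0 zC)// cscale1.
move=> tC; have [s sC ->] := rot_dist_attained u w.
have := @rot_dist_le u (cscale t w) (s * t^-1) (CrotM sC (CrotV tC)).
by rewrite cscaleA divfK ?(Crot_neq0 tC).
Qed.

Lemma rot_distC u v : rot_dist u v = rot_dist v u.
Proof.
suff le w t : rot_dist w t <= rot_dist t w by apply/le_anti; rewrite !le.
have [z zC ->] := rot_dist_attained t w.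
have <- : `|w - cscale z^-1 t| = `|t - cscale z w|.
  rewrite -(norm_cscale_Crot (w - _) zC) cscaleB cscaleA.
  by rewrite mulfV ?(Crot_neq0 zC)// cscale1 distrC.
exact/rot_dist_le/CrotV.
Qed.

Definition orbit_dist (q q' : orbit_space) : R := rot_dist (repr q) (repr q').

Let orbit_distxx q : orbit_dist q q = 0.
Proof.
apply/le_anti; rewrite (le_trans (rot_dist_le _ _ (Crot1 R r))) ?cscale1 ?subrr ?normr0//=.
by rewrite /orbit_dist; have [z _ ->] := rot_dist_attained (repr q) (repr q).
Qed.

Let orbit_dist_positivity q q' : orbit_dist q q' = 0 -> q = q'.
Proof.
rewrite /orbit_dist; have [z zC ->] := rot_dist_attained (repr q) (repr q').
move=> /normr0_eq0/eqP; rewrite subr_eq0 => /eqP h.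
rewrite -[q]reprK -[q']reprK; apply/orbit_eqP; by exists z.
Qed.

Let orbit_distC q q' : orbit_dist q q' = orbit_dist q' q.
Proof. exact: rot_distC. Qed.

Let orbit_dist_triangle q2 q1 q3 :
  orbit_dist q1 q3 <= orbit_dist q1 q2 + orbit_dist q2 q3.
Proof.
rewrite /orbit_dist; move: (repr q1) (repr q2) (repr q3) => u v w.
have [z zC ->] := rot_dist_attained u v; have [t tC ->] := rot_dist_attained v w.
apply: le_trans (rot_dist_le _ _ (CrotM zC tC)) _.
rewrite -(norm_cscale_Crot (v - _) zC) cscaleB cscaleA.
by apply: le_trans (ler_normD _ _); rewrite addrA subrK.
Qed.

HB.instance Definition _ := isMetric.Build R orbit_space
  orbit_distxx orbit_dist_positivity orbit_distC orbit_dist_triangle.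

Lemma mdist_orbit u v :
  mdist (orbit_class u) (orbit_class v) = inf [set `|u - cscale z v| | z in Crot r].
Proof.
have repr_orbit w : exists2 z, Crot r z & repr (orbit_class w) = cscale z w.
  by apply/orbit_eqP; rewrite /orbit_class reprK.
rewrite /mdist /= /orbit_dist -/(rot_dist u v).
have [z zC ->] := repr_orbit u; have [t tC ->] := repr_orbit v.
by rewrite rot_dist_scaler// rot_distC rot_dist_scaler// rot_distC.
Qed.

End OrbitSpace.

Section Embedding.
Variables (R : realType) (n r : nat).
Local Notation V := (Cspace R 'I_n).
Local Notation target :=
  (hilbert_prod (tensor_power R n 2) (tensor_power R n r)).

Let Frep (u : V) : target :=
  (cos (pi / (2 * r%:R)) *: phi u, sin (pi / (2 * r%:R)) *: psi r u).

Definition Fmap (q : orbit_space R n r) : target := Frep (repr q).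

Lemma Fmap_orbit u : Fmap (orbit_class r u) =
  (cos (pi / (2 * r%:R)) *: phi u, sin (pi / (2 * r%:R)) *: psi r u).
Proof.
have [z zC ru] : exists2 z, Crot r z & repr (orbit_class r u) = cscale z u.
  by apply/orbit_eqP; rewrite /orbit_class reprK.
rewrite /Fmap /Frep ru; have [->|u0] := eqVneq u 0.
  suff -> : cscale z (0 : V) = 0 by [].
  by apply/ffunP => i; rewrite !ffunE mulr0.
have zu0 : (cscale z u == 0) = false.
  by apply/negbTE; rewrite -normr_eq0 (norm_cscale_Crot _ zC) normr_eq0.
rewrite /phi /psi zu0 (negbTE u0) (norm_cscale_Crot _ zC).
congr (_ *: (_ *: _), _ *: (_ *: _)); apply/ffunP => s; rewrite !ffunE.
  rewrite !big_ord_recl !big_ord0 !mulr1 /= !ffunE rmorphM mulrACA.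
  by have -> : z * z^*%C = 1 := Crot_conj zC; rewrite mul1r.
under eq_bigr do rewrite ffunE.
by rewrite big_split /= prodr_const card_ord (Crot_expr zC) mul1r.
Qed.

End Embedding.

Section Distortion.
Variable R : realType.
Local Open Scope ereal_scope.

Definition lower_lip (X Y : metricType R) (f : X -> Y) : \bar R :=
  ereal_sup [set a | 0 <= a /\
    forall x x', a * (mdist x x')%:E <= (mdist (f x) (f x'))%:E].

Definition upper_lip (X Y : metricType R) (f : X -> Y) : \bar R :=
  ereal_inf [set b | 0 <= b /\
    forall x x', (mdist (f x) (f x'))%:E <= b * (mdist x x')%:E].

(* The sup and inf above are attained, so they are the largest and smallest
   such constants. *)
Lemma lower_lipP (X Y : metricType R) (f : X -> Y) x x' :
  lower_lip f * (mdist x x')%:E <= (mdist (f x) (f x'))%:E.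
Proof.
have [->|xx'] := eqVneq x x'; first by rewrite !mdistxx mule0.
have d0 : (0 < mdist x x')%R by rewrite mdist_gt0.
rewrite -lee_pdivlMr//; apply: ge_ereal_sup => a [_ /(_ x x')].
by rewrite lee_pdivlMr.
Qed.

Lemma upper_lipP (X Y : metricType R) (f : X -> Y) x x' :
  (mdist (f x) (f x'))%:E <= upper_lip f * (mdist x x')%:E.
Proof.
have [->|xx'] := eqVneq x x'; first by rewrite !mdistxx mule0.
have d0 : (0 < mdist x x')%R by rewrite mdist_gt0.
rewrite -lee_pdivrMr//; apply: le_ereal_inf_tmp => b [_ /(_ x x')].
by rewrite lee_pdivrMr.
Qed.

Definition distortion (X Y : metricType R) (f : X -> Y) : \bar R :=
  if (lower_lip f == 0) || (upper_lip f == +oo) then +oo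
  else upper_lip f / lower_lip f.

Definition euclidean_distortion (X : metricType R) : \bar R :=
  ereal_inf [set c | exists (H : hilbertType R) (f : X -> H), distortion f = c].

End Distortion.

(* Main.v *)
(* Put t = pi / (2r), c = cos t, s = sin t. Choose v in its orbit closest to u;
   then <u, v> = |u| |v| x e^(i th) with 0 <= x <= 1 and, up to conjugation,
   0 <= th <= pi / r. In these terms
     d^2 = |u|^2 + |v|^2 - 2 |u| |v| x cos th,
     |F[u] - F[v]|^2 = |u|^2 + |v|^2 - 2 |u| |v| (c^2 x^2 + s^2 x^r cos (r th)),
   so the two bounds reduce to scalar inequalities in x and th. At x = 1 they are
   sin (th/2) <= s sin (r th/2) and |sin (r th/2)| <= r |sin (th/2)|; the general
   case follows from (r - 1) s^2 <= c^2 and 2 c^2 <= r (r - 1) s^2, respectively.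

   Optimality: on the 2N points [e^(i pi j / (r N)) e_0] every map to a Hilbert
   space satisfies the Poincare inequality of the 2N-cycle,
     sin^2 (pi / 2N) \sum |f (j + N) - f j|^2 <= \sum |f (j + 1) - f j|^2.
   The antipodal distances are at least 2 s and the steps at most
   2 sin (pi / (2 r N)), so the distortion is at least
   s sin (pi / 2N) / sin (pi / (2 r N)), which tends to r s. For N a power of 2 the
   Poincare inequality follows by repeated halving of the shift, starting from a
   quarter turn, where the autocorrelation of an antiperiodic sequence vanishes. *)

Require Import Defs.
From mathcomp Require Import all_boot all_order all_algebra.
From mathcomp Require Import all_classical all_reals all_analysis.
From mathcomp Require Import complex zify ring lra.
Import Order.TTheory GRing.Theory Num.Theory.
Import numFieldNormedType.Exports.
(* Restores the [cscale] of [Defs], shadowed by the one of the analysis library. *)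
Import Defs.
Local Open Scope ring_scope.
Set Implicit Arguments.
Unset Strict Implicit.
Unset Printing Implicit Defensive.

(** * Trigonometric inequalities *)

Section MultipleAngles.
Variable R : realType.
Implicit Types (x y t : R) (k : nat).

Lemma cosS_mul k t :
  cos (k.+1%:R * t) = cos (k%:R * t) * cos t - sin (k%:R * t) * sin t.
Proof. by rewrite -natr1 mulrDl mul1r cosD. Qed.

Lemma sinS_mul k t :
  sin (k.+1%:R * t) = sin (k%:R * t) * cos t + cos (k%:R * t) * sin t.
Proof. by rewrite -natr1 mulrDl mul1r sinD. Qed.

Lemma sin_ge0_quarter t : 0 <= t -> t <= pi / 2 -> 0 <= sin t.
Proof.
move=> t0 t1; apply: sin_ge0_pi; rewrite ?in_itv /= t0 /=.
by have := pi_gt0 R; lra.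
Qed.

Lemma cos_ge0_quarter t : 0 <= t -> t <= pi / 2 -> 0 <= cos t.
Proof.
move=> t0 t1; apply: cos_ge0_pihalf; rewrite ?in_itv /= t1 andbT.
by have := pi_gt0 R; lra.
Qed.

Lemma ler_natSl k t y : 0 <= t -> k.+1%:R * t <= y -> k%:R * t <= y.
Proof. by move=> t0; apply: le_trans; rewrite ler_wpM2r// ler_nat. Qed.

(** The signs that let the addition formulas be estimated term by term in the inductions below. *)
Lemma natmul_quarter k t : 0 <= t -> k.+1%:R * t <= pi / 2 ->
  [/\ 0 <= sin t, 0 <= cos t, 0 <= sin (k%:R * t) & 0 <= cos (k%:R * t)].
Proof.
move=> t0 kt; have kt0 : 0 <= k%:R * t by rewrite mulr_ge0.
have t1 : t <= pi / 2.
  by apply: le_trans kt; rewrite -natr1 mulrDl mul1r lerDr.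
have kt1 := ler_natSl t0 kt.
by split; [exact: sin_ge0_quarter|exact: cos_ge0_quarter|
  exact: sin_ge0_quarter|exact: cos_ge0_quarter].
Qed.

(** The second bound is [sin (k t) <= k cos^(k-1) t sin t] multiplied by [cos t], to avoid the
    exponent [k - 1]. Its induction step uses the first bound, hence the joint statement. *)
Lemma cos_sin_natmul_le k t : 0 <= t -> k%:R * t <= pi / 2 ->
  cos (k%:R * t) <= cos t ^+ k
  /\ sin (k%:R * t) * cos t <= k%:R * cos t ^+ k * sin t.
Proof.
move=> t0; elim: k => [|k IH] kt.
  by rewrite !mul0r sin0 cos0 expr0 !mul0r.
have [s0 c0 ks kc] := natmul_quarter t0 kt.
have [h1 h2] := IH (ler_natSl t0 kt).
rewrite cosS_mul sinS_mul -natr1 exprSr; split.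
  have := ler_wpM2r c0 h1; have := mulr_ge0 ks s0; lra.
have := ler_wpM2r c0 h2.
have := ler_wpM2r (mulr_ge0 c0 s0) h1.
lra.
Qed.

(* Truncation of the binomial expansion of [Re ((cos t + i sin t) ^ k)], multiplied
   by [cos t ^ 2] so that no exponent [k - 2] occurs. *)
Lemma cos_natmul_ge k t : 0 <= t -> k%:R * t <= pi / 2 ->
  cos t ^+ k * (cos t ^+ 2 - k%:R * (k%:R - 1) / 2 * sin t ^+ 2)
    <= cos (k%:R * t) * cos t ^+ 2.
Proof.
move=> t0; elim: k => [|k IH] kt; first by rewrite !mul0r cos0; lra.
have [s0 c0 ks kc] := natmul_quarter t0 kt.
have kt' := ler_natSl t0 kt.
have [_ h2] := cos_sin_natmul_le t0 kt'.
have h1 := IH kt'.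
rewrite cosS_mul -natr1 exprSr.
have := ler_wpM2r c0 h1.
have := ler_wpM2r (mulr_ge0 c0 s0) h2.
set C := cos t; set S := sin t; set X := cos _; set Y := sin _; set P := C ^+ k.
nra.
Qed.

Lemma sin_natmul_le k t : 0 <= t -> k%:R * t <= pi / 2 ->
  sin (k%:R * t) <= k%:R * sin t.
Proof.
move=> t0; elim: k => [|k IH] kt; first by rewrite !mul0r sin0.
have [s0 c0 ks kc] := natmul_quarter t0 kt.
have h1 := IH (ler_natSl t0 kt).
rewrite sinS_mul -natr1.
have := ler_wpM2r s0 (cos_le1 (k%:R * t)).
have := ler_wpM2l ks (cos_le1 t).
lra.
Qed.

(** [tan (k t) >= k tan t] with denominators cleared, so that [k t = pi / 2] is allowed. The
    induction step drops a nonnegative multiple of [sin (k t) sin^2 t]. *)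
Lemma tan_natmul_ge k t : 0 <= t -> k%:R * t <= pi / 2 ->
  k%:R * sin t * cos (k%:R * t) <= sin (k%:R * t) * cos t.
Proof.
move=> t0; elim: k => [|k IH] kt; first by rewrite !mul0r sin0 mul0r.
have [s0 c0 ks kc] := natmul_quarter t0 kt.
have h1 := IH (ler_natSl t0 kt).
rewrite sinS_mul cosS_mul -natr1.
have := ler_wpM2r c0 h1.
have := mulr_ge0 (mulr_ge0 ks (sqr_ge0 (sin t))) (ler0n R k.+1).
rewrite -natr1 !expr2.
lra.
Qed.

(** The ratio [sin (k y) / sin y] is nonincreasing in [y]: passing to [k + 1] turns it into
    [(sin (k y) / sin y) cos y + cos (k y)], where every factor is nonnegative and nonincreasing. *)
Lemma sin_natmul_ratio k x y : 0 <= x -> x <= y -> k%:R * y <= pi / 2 ->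
  sin (k%:R * y) * sin x <= sin (k%:R * x) * sin y.
Proof.
move=> x0 xy; have y0 := le_trans x0 xy.
elim: k => [|k IH] ky; first by rewrite !mul0r sin0 !mul0r.
have kx : k.+1%:R * x <= pi / 2 by apply: le_trans ky; rewrite ler_wpM2l.
have [sx cx ksx kcx] := natmul_quarter x0 kx.
have [sy cy ksy kcy] := natmul_quarter y0 ky.
have h1 := IH (ler_natSl y0 ky).
have p0 := pi_gt0 R.
have mono z w : 0 <= z -> z <= w -> w <= pi / 2 -> cos w <= cos z.
  by move=> z0 zw w1; rewrite leNgt ltr_cos ?in_itv /= -?leNgt//; lra.
have cxy : cos y <= cos x.
  by apply: mono => //; apply: le_trans ky; rewrite -natr1 mulrDl mul1r lerDr mulr_ge0.
have kcxy : cos (k%:R * y) <= cos (k%:R * x).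
  by apply: mono; [rewrite mulr_ge0|rewrite ler_wpM2l|exact: ler_natSl ky].
rewrite !sinS_mul.
have := ler_wpM2r cx h1.
have := ler_wpM2l (mulr_ge0 ksy sx) cxy.
have := ler_wpM2r (mulr_ge0 sx sy) kcxy.
nra.
Qed.
End MultipleAngles.

(** * Scalar inequalities in the modulus [x] and the angle [th] *)

Section ScalarInequalities.
Variables (R : realType) (r : nat).
Hypothesis r2 : (2 <= r)%N.
Implicit Types x y th : R.

Lemma half_angle_quarter : r%:R * (pi / (2 * r%:R)) = pi / 2 :> R.
Proof. by field; rewrite pnatr_eq0; case: r r2. Qed.

Lemma half_angle_gt0 : 0 < pi / (2 * r%:R) :> R.
Proof. by rewrite divr_gt0 ?pi_gt0// mulr_gt0// ltr0n; case: r r2. Qed.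

Local Notation t := (pi / (2 * r%:R) : R).
Local Notation c := (cos t).
Local Notation s := (sin t).

Let t0 : 0 <= t. Proof. exact/ltW/half_angle_gt0. Qed.

Let r_ge2 : 2 <= r%:R :> R. Proof. by rewrite ler_nat. Qed.

Lemma half_angle_le : t <= pi / 4.
Proof. by have := half_angle_quarter; have := ler_wpM2r t0 r_ge2; lra. Qed.

Lemma cos_half_angle_gt0 : 0 < c.
Proof.
apply: cos_gt0_pihalf; have := half_angle_gt0; have := half_angle_le.
have := pi_gt0 R; lra.
Qed.

Lemma sin_half_angle_gt0 : 0 < s.
Proof.
apply: sin_gt0_pi; have := half_angle_gt0; have := half_angle_le.
have := pi_gt0 R; lra.
Qed.

(* This is [tan (k t) >= k tan t] for [k = r - 1], as [tan (k t) = 1 / tan t]. *)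
Lemma pred_mul_sin2_le : (r%:R - 1) * s ^+ 2 <= c ^+ 2.
Proof.
have [k rk] : exists k, r = k.+1 by case: r r2 => // k; exists k.
have rk1 : r%:R - 1 = k%:R :> R by rewrite rk -natr1 addrK.
have kt : k%:R * t = pi / 2 - t.
  by rewrite -half_angle_quarter -rk1; ring.
have := @tan_natmul_ge R k t t0; rewrite kt rk1.
rewrite sinB cosB sin_pihalf cos_pihalf.
have := half_angle_gt0; nra.
Qed.

(** Since [r t = pi / 2], the right side of [cos_natmul_ge] vanishes at [k = r], and the positive
    factor [c^r] cancels. *)
Lemma cos2_le_sin2 : 2 * c ^+ 2 <= r%:R * (r%:R - 1) * s ^+ 2.
Proof.
have := @cos_natmul_ge R r t t0; rewrite half_angle_quarter cos_pihalf mul0r.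
move=> /(_ (lexx _)); rewrite pmulr_rle0 ?exprn_gt0 ?cos_half_angle_gt0//.
lra.
Qed.

Lemma mul_sin_half_angle_ge1 : 1 <= r%:R * s.
Proof.
by have := @sin_natmul_le R r t t0; rewrite half_angle_quarter sin_pihalf; exact.
Qed.

Let half_range th : 0 <= th -> th <= pi / r%:R ->
  [/\ 0 <= th / 2, th / 2 <= t & r%:R * (th / 2) <= pi / 2].
Proof.
move=> th0 th1; have h : th / 2 <= t.
  rewrite (_ : t = pi / r%:R / 2); first by lra.
  by field; rewrite pnatr_eq0; case: r r2.
split=> //; first lra.
by rewrite -half_angle_quarter ler_wpM2l.
Qed.

Let cosE x : cos x = 1 - 2 * sin (x / 2) ^+ 2.
Proof. by rewrite {1}(splitr x) cosD sin2cos2 -!expr2 sin2cos2; ring. Qed.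

(** The lower bound at [x = 1]. In half angles: [sin (r y) / sin y] at [y = th / 2] is at least its
    value [1 / s] at the endpoint [y = t]. *)
Lemma sin2_cos_mul_le_cos th : 0 <= th -> th <= pi / r%:R ->
  c ^+ 2 + s ^+ 2 * cos (r%:R * th) <= cos th.
Proof.
move=> th0 th1; have [h0 ht hq] := half_range th0 th1.
have := sin_natmul_ratio (k := r) h0 ht.
rewrite half_angle_quarter sin_pihalf mul1r => /(_ (lexx _)) h.
have s0 : 0 <= sin (th / 2).
  by apply: sin_ge0_quarter => //; have := half_angle_le; have := pi_gt0 R; lra.
rewrite (cosE th) (cosE (r%:R * th)) -mulrA cos2sin2.
have : sin (th / 2) ^+ 2 <= (sin (r%:R * (th / 2)) * s) ^+ 2.
  by apply: lerXn2r => //; rewrite nnegrE// (le_trans s0).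
rewrite exprMn; nra.
Qed.

(** The upper bound at [x = 1]: in half angles it is the square of [sin (r y) <= r sin y]. *)
Lemma one_sub_cos_mul_le th : 0 <= th -> th <= pi / r%:R ->
  1 - cos (r%:R * th) <= r%:R ^+ 2 * (1 - cos th).
Proof.
move=> th0 th1; have [h0 ht hq] := half_range th0 th1.
have h := sin_natmul_le h0 hq.
have s0 := sin_ge0_quarter (mulr_ge0 (ler0n R r) h0) hq.
rewrite (cosE th) (cosE (r%:R * th)) -mulrA.
have : sin (r%:R * (th / 2)) ^+ 2 <= (r%:R * sin (th / 2)) ^+ 2.
  by apply: lerXn2r => //; rewrite nnegrE// (le_trans s0).
rewrite exprMn; nra.
Qed.

Lemma bernoulli_le k x : 0 <= x -> x <= 1 -> 1 - x ^+ k <= k%:R * (1 - x).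
Proof.
move=> x0 x1; elim: k => [|k IH]; first by rewrite expr0 mul0r subrr.
rewrite exprS -natr1; have := exprn_ge0 k x0; have := exprn_ile1 k x0 x1.
nra.
Qed.

Lemma embedding_lower x th : 0 <= x -> x <= 1 -> 0 <= th -> th <= pi / r%:R ->
  c ^+ 2 * x ^+ 2 + s ^+ 2 * (x ^+ r * cos (r%:R * th)) <= x * cos th.
Proof.
move=> x0 x1 th0 th1; have h1 := sin2_cos_mul_le_cos th0 th1.
have h2 := pred_mul_sin2_le.
have [k rk] : exists k, r = k.+1 by case: r r2 => // k; exists k.
set E := cos (r%:R * th) in h1 *.
have E1 : -1 <= E by exact: cos_geN1.
have rk1 : r%:R - 1 = k%:R :> R by rewrite rk -natr1 addrK.
rewrite rk1 in h2; have b := bernoulli_le k x0 x1.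
have p1 : x ^+ k <= 1 by exact: exprn_ile1.
rewrite {3}rk [x ^+ k.+1]exprS; set P := x ^+ k in b p1 *.
have s20 := sqr_ge0 s.
(* After division by [x] the claim is [c^2 x + s^2 P E <= cos th] with [P = x^(r-1)]. By [h1] it
   follows from [g2], whose worst case [E = -1] is [g1]. *)
have g1 : s ^+ 2 * (1 - P) <= c ^+ 2 * (1 - x).
  have x1' : 0 <= 1 - x by lra.
  have := ler_wpM2l s20 b; have := ler_wpM2r x1' h2; lra.
have g2 : 0 <= c ^+ 2 * (1 - x) + s ^+ 2 * (1 - P) * E.
  have A0 : 0 <= s ^+ 2 * (1 - P) by apply: mulr_ge0 => //; lra.
  have E1' : 0 <= 1 + E by lra.
  have := mulr_ge0 A0 E1'; lra.
have : 0 <= cos th - c ^+ 2 * x - s ^+ 2 * P * E by lra.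
move=> /(mulr_ge0 x0); lra.
Qed.

Lemma embedding_upper x th : 0 <= x -> x <= 1 -> 0 <= th -> th <= pi / r%:R ->
  1 - (c ^+ 2 * x ^+ 2 + s ^+ 2 * (x ^+ r * cos (r%:R * th)))
    <= (r%:R * s) ^+ 2 * (1 - x * cos th).
Proof.
move=> x0 x1 th0 th1; have h1 := one_sub_cos_mul_le th0 th1.
have h2 := cos2_le_sin2.
set E := cos (r%:R * th) in h1 *.
have E1 : E <= 1 by exact: cos_le1.
have b := bernoulli_le r x0 x1; have b2 := bernoulli_le 2 x0 x1.
have px : x ^+ r <= x.
  by rewrite -[leRHS]expr1 ler_wiXn2l// (leq_trans _ r2).
have s20 := sqr_ge0 s; have c20 := sqr_ge0 c.
(* As [c^2 + s^2 = 1], the left side is [c^2 (1 - x^2) + s^2 (1 - x^r) + s^2 x^r (1 - E)]. By [g2],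
   [g3], [g4] the first two terms add up to at most [r^2 s^2 (1 - x)]; [g1] bounds the third. *)
have g1 : s ^+ 2 * (x ^+ r * (1 - E)) <= s ^+ 2 * (x * (r%:R ^+ 2 * (1 - cos th))).
  apply: ler_wpM2l => //; apply: le_trans (_ : x * (1 - E) <= _).
    by apply: ler_wpM2r => //; lra.
  exact: ler_wpM2l.
have g2 := ler_wpM2l s20 b; have g3 := ler_wpM2l c20 b2.
have x1' : 0 <= 1 - x by lra.
have g4 := ler_wpM2r x1' h2.
have g5 := cos2Dsin2 t.
rewrite exprMn; nra.
Qed.

Lemma embedding_bounds a b x th : 0 <= a -> 0 <= b ->
  0 <= x -> x <= 1 -> 0 <= th -> th <= pi / r%:R ->
  let D := a ^+ 2 + b ^+ 2 - 2 * (a * b * (x * cos th)) in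
  let E := a ^+ 2 + b ^+ 2
    - 2 * (a * b * (c ^+ 2 * x ^+ 2 + s ^+ 2 * (x ^+ r * cos (r%:R * th)))) in
  D <= E /\ E <= (r%:R * s) ^+ 2 * D.
Proof.
move=> a0 b0 x0 x1 th0 th1 D E; rewrite {}/D {}/E.
have lo := embedding_lower x0 x1 th0 th1.
have up := embedding_upper x0 x1 th0 th1.
have ab0 := mulr_ge0 a0 b0.
split; first by have := ler_wpM2l ab0 lo; lra.
(* Both squared distances are [(a - b)^2] plus a multiple of [2 a b]. [embedding_upper] compares the
   multiples, and [r s >= 1] takes care of [(a - b)^2]. *)
have rs1 : 1 <= (r%:R * s) ^+ 2.
  by rewrite expr2; have := mul_sin_half_angle_ge1; nra.
have := ler_wpM2l ab0 up; have := sqr_ge0 (a - b).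
set X := (r%:R * s) ^+ 2 in rs1 *; nra.
Qed.
End ScalarInequalities.

(** * The Poincare inequality on a cycle *)

Section InnerProduct.
Variables (R : realType) (H : preHilbertType R).
Implicit Types x y z : H.

Lemma innerDl x y z : inner (x + y) z = inner x z + inner y z.
Proof. by have := inner_linearl 1 x y z; rewrite scale1r mul1r. Qed.

Lemma inner0l z : inner 0 z = 0 :> R.
Proof. by apply: (@addrI _ (inner 0 z)); rewrite -innerDl !addr0. Qed.

Lemma innerZl a x z : inner (a *: x) z = a * inner x z.
Proof. by have := inner_linearl a x 0 z; rewrite inner0l !addr0. Qed.

Lemma innerNl x z : inner (- x) z = - inner x z.
Proof. by rewrite -scaleN1r innerZl mulN1r. Qed.

Lemma innerDr x y z : inner z (x + y) = inner z x + inner z y.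
Proof. by rewrite innerC innerDl ![inner z _]innerC. Qed.

Lemma innerZr a x z : inner z (a *: x) = a * inner z x.
Proof. by rewrite innerC innerZl [inner z _]innerC. Qed.

Lemma innerNr x z : inner z (- x) = - inner z x.
Proof. by rewrite innerC innerNl innerC. Qed.

Lemma normB_sqr x y : `|x - y| ^+ 2 = `|x| ^+ 2 + `|y| ^+ 2 - 2 * inner x y.
Proof.
rewrite -!inner_norm !(innerDl, innerDr, innerNl, innerNr) [inner y x]innerC.
ring.
Qed.
End InnerProduct.

Section PeriodicSums.
Variables (R : realType).

Lemma sum_shift (h : nat -> R) m d : (forall j, h (j + m)%N = h j) ->
  \sum_(j < m) h (j + d)%N = \sum_(j < m) h j.
Proof.
move=> hm; elim: d => [|d <-]; first by under eq_bigr do rewrite addn0.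
case: m hm => [|m] hm; first by rewrite !big_ord0.
rewrite big_ord_recr [RHS]big_ord_recl /= addrC; congr (_ + _).
  by rewrite -[RHS]hm; congr h; rewrite add0n; lia.
by apply: eq_bigr => i _; congr h; rewrite /bump /=; lia.
Qed.
End PeriodicSums.

Section CyclicPoincare.
Variables (R : realType) (H : preHilbertType R).

Section Antiperiodic.
Variables (g : nat -> H) (N : nat).
Hypothesis gN : forall j, g (j + N)%N = - g j.

Let g2N j : g (j + 2 * N)%N = g j.
Proof. by rewrite mul2n -addnn addnA !gN opprK. Qed.

(** The autocorrelation of [g] at lag [d] over a full period. *)
Let C d := \sum_(j < 2 * N) inner (g j) (g (j + d)%N).

Let C_shift d e : \sum_(j < 2 * N) inner (g (j + e)%N) (g (j + e + d)%N) = C d.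
Proof.
apply: (@sum_shift _ (fun j => inner (g j) (g (j + d)%N))) => j.
by rewrite [(_ + 2 * N + _)%N]addnAC !g2N.
Qed.

(* [0 <= \sum_j `|g j + g (j + 2d) - 2 cos x *: g (j + d)| ^+ 2] gives
   [4 cos x * C d <= 2 * C 0 + 2 * C (2d) + 4 cos^2 x * C 0 - 4 cos x * C d]. *)
Let C_half d x : 0 < cos x -> C (d * 2) <= cos (x *+ 2) * C 0 ->
  C d <= cos x * C 0.
Proof.
move=> cx; rewrite mulr2n cosD -!expr2 sin2cos2 => hC.
set k := cos x in cx hC *.
have : 0 <= \sum_(j < 2 * N) `|g j + g (j + d * 2)%N - (2 * k) *: g (j + d)%N| ^+ 2.
  by apply: sumr_ge0 => j _; rewrite sqr_ge0.
have E j : `|g j + g (j + d * 2)%N - (2 * k) *: g (j + d)%N| ^+ 2 =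
   inner (g j) (g (j + 0)%N)
   + inner (g (j + d * 2)%N) (g (j + d * 2 + 0)%N)
   + 2 * inner (g j) (g (j + d * 2)%N)
   + 4 * k ^+ 2 * inner (g (j + d)%N) (g (j + d + 0)%N)
   - 4 * k * inner (g j) (g (j + d)%N)
   - 4 * k * inner (g (j + d)%N) (g (j + d + d)%N).
  rewrite !addn0 (_ : (j + d + d = j + d * 2)%N); last lia.
  rewrite -inner_norm !(innerDl, innerDr, innerNl, innerNr, innerZl, innerZr).
  rewrite [inner (g (j + d * 2)%N) (g j)]innerC [inner (g (j + d)%N) (g j)]innerC.
  rewrite [inner (g (j + d * 2)%N) (g (j + d)%N)]innerC; ring.
under eq_bigr do rewrite E.
rewrite !sumrB !big_split /= -!mulr_sumr !C_shift -!/(C _).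
rewrite -[C d <= _](ler_pM2l cx); lra.
Qed.

(** Shifting by [d] turns each term into the inner product of [g (j + d)] and
    [g (j + N) = - g j]. *)
Let C_quarter d : (d * 2 = N)%N -> C d = 0.
Proof.
move=> dN; suff : C d = - C d by lra.
rewrite -{1}(C_shift d d) /C -sumrN; apply: eq_bigr => j _.
by rewrite -addnA addnn -muln2 dN gN innerNr innerC.
Qed.

(** With [2N] steps to a full turn, lag [d] is the angle [pi d / N = pi / 2^(i+1)]. Each induction
    step halves lag and angle. *)
Let C_dyadic i d : (2 ^ i * d * 2 = N)%N -> C d <= cos (pi / 2 ^+ i.+1) * C 0.
Proof.
elim: i d => [|i IH] d dN.
  by rewrite expr1 cos_pihalf mul0r C_quarter// -dN; lia.
have p0 := pi_gt0 R.
have h2 : pi / 2 ^+ i.+2 *+ 2 = pi / 2 ^+ i.+1 :> R.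
  by rewrite [2 ^+ i.+2]exprS; field; rewrite expf_neq0.
apply: C_half; last by rewrite h2; apply: IH; rewrite -dN expnS; lia.
apply: cos_gt0_pihalf.
have e2 : 2 <= 2 ^+ i.+1 :> R by rewrite -[leLHS]expr1 ler_weXn2l// ler1n.
have : pi / 2 ^+ i.+1 <= pi / 2 :> R.
  by apply: ler_wpM2l; [exact: ltW|rewrite lef_pV2 ?posrE// exprn_gt0].
have : 0 < pi / 2 ^+ i.+2 :> R by rewrite divr_gt0// exprn_gt0.
move: h2; rewrite mulr2n; set a := pi / _; set b := pi / _; lra.
Qed.

(** The right side equals [2 C 0 - 2 C 1], and [C_dyadic] at lag 1 gives
    [C 1 <= cos (pi / N) C 0]. *)
Lemma antiperiodic_wirtinger i : (N = 2 ^ i.+1)%N ->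
  4 * sin (pi / (2 * N%:R)) ^+ 2 * (\sum_(j < 2 * N) `|g j| ^+ 2)
    <= \sum_(j < 2 * N) `|g (j + 1)%N - g j| ^+ 2.
Proof.
move=> NE; have := @C_dyadic i 1%N; rewrite muln1 -expnSr -NE => /(_ erefl).
rewrite -natrX -NE (_ : pi / N%:R = pi / (2 * N%:R) *+ 2); last first.
  by rewrite mulr2n; field; rewrite NE pnatr_eq0 expn_eq0.
rewrite mulr2n cosD -!expr2 cos2sin2.
have -> : \sum_(j < 2 * N) `|g j| ^+ 2 = C 0.
  by apply: eq_bigr => j _; rewrite addn0 inner_norm.
have -> : \sum_(j < 2 * N) `|g (j + 1)%N - g j| ^+ 2 = 2 * C 0 - 2 * C 1.
  rewrite (_ : 2 * C 0 - _ = C 0 + C 0 - (C 1 + C 1)); last ring.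
  rewrite -{1}(C_shift 0 1) -{2}/(C 0) /C -!big_split -sumrB /=.
  apply: eq_bigr => j _; rewrite !addn0 normB_sqr -!inner_norm.
  rewrite [inner (g (j + 1)%N) (g j)]innerC; ring.
lra.
Qed.
End Antiperiodic.

(** The difference [g] of opposite values of [f] is antiperiodic, so Wirtinger applies to it. Each
    increment of [g] is a difference [x - y] of increments of [f]; [|x - y|^2 <= 2 |x|^2 + 2 |y|^2]
    costs a factor 4, which cancels the one in Wirtinger. *)
Lemma cyclic_poincare (f : nat -> H) i N : (N = 2 ^ i.+1)%N ->
  (forall j, f (j + 2 * N)%N = f j) ->
  sin (pi / (2 * N%:R)) ^+ 2 * (\sum_(j < 2 * N) `|f (j + N)%N - f j| ^+ 2)
    <= \sum_(j < 2 * N) `|f (j + 1)%N - f j| ^+ 2.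
Proof.
move=> NE fN; pose g j := f (j + N)%N - f j.
have gN j : g (j + N)%N = - g j.
  by rewrite /g -addnA addnn -mul2n fN opprB.
have := antiperiodic_wirtinger gN NE; rewrite /g.
set S := \sum_(j < _) _; set T := \sum_(j < _) _; set U := \sum_(j < _) _ => hST.
suff : T <= 4 * U by lra.
have US : U = \sum_(j < 2 * N) `|f (j + N + 1)%N - f (j + N)%N| ^+ 2.
  rewrite (@sum_shift _ (fun j => `|f (j + 1)%N - f j| ^+ 2))// => j.
  by rewrite addnAC !fN.
have -> : 4 * U = 2 * U + 2 * U by ring.
rewrite {1}US !mulr_sumr -big_split /=; apply: ler_sum => j _.
rewrite (addnAC j 1 N); set x := f _ - f (j + N)%N; set y := f (j + 1)%N - f j.
have -> : f (j + N + 1)%N - f (j + 1)%N - (f (j + N)%N - f j) = x - y.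
  by rewrite /x /y !opprB addrACA [RHS]addrACA [- f (j + 1)%N - _]addrC.
move: x y => x y; have := sqr_ge0 `|x - - y|; rewrite !normB_sqr innerNr normrN; lra.
Qed.
End CyclicPoincare.

(** * The bounds for the embedding *)

Section RootSector.
Variable R : realType.
Implicit Types (z : R[i]) (x th rho : R).

Lemma polarX rho x k :
  (rho * cos x +i* (rho * sin x))%C ^+ k =
  (rho ^+ k * cos (k%:R * x) +i* (rho ^+ k * sin (k%:R * x)))%C.
Proof.
elim: k => [|k IH]; first by rewrite !expr0 !mul0r cos0 sin0 !mul1r.
rewrite exprSr IH cosS_mul sinS_mul exprSr.
by apply/eqP; rewrite eq_complex /=; apply/andP; split; apply/eqP; ring.
Qed.

(** The sign [e] splits off complex conjugation, which keeps [th] in [[0, pi]], where [cos] is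
    monotone. *)
Lemma polar_decomposition z : exists rho th e,
  [/\ 0 <= rho, 0 <= th, th <= pi, e = 1 \/ e = -1 &
      z = (rho * cos (e * th) +i* (rho * sin (e * th)))%C].
Proof.
case: z => p q; pose rho := Num.sqrt (p ^+ 2 + q ^+ 2).
have rho0 : 0 <= rho by exact: sqrtr_ge0.
have rho2 : rho ^+ 2 = p ^+ 2 + q ^+ 2 by rewrite sqr_sqrtr// addr_ge0 ?sqr_ge0.
have [r0|rn0] := eqVneq rho 0.
  exists 0, 0, 1; split => //; [exact: pi_ge0|by left|].
  move/eqP: rho2; rewrite r0 expr0n eq_sym paddr_eq0 ?sqr_ge0// !sqrf_eq0 /=.
  by move=> /andP[/eqP-> /eqP->]; rewrite !mul0r.
have rp : 0 < rho by rewrite lt_neqAle eq_sym rn0.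
have pr : -1 <= p / rho <= 1.
  rewrite ler_pdivlMr// ler_pdivrMr// mul1r mulN1r -ler_norml.
  by rewrite -ler_sqr ?nnegrE// real_normK ?num_real// rho2 lerDl sqr_ge0.
have [/andP[th0 th1] cth] := acos_def pr.
set th := acos _ in th0 th1 cth.
have sth : 0 <= sin th by apply: sin_ge0_pi; rewrite th0.
have pE : p = rho * cos th by rewrite cth mulrC divfK.
have qE : `|q| = rho * sin th.
  apply/eqP; rewrite -(@eqrXn2 _ 2) ?mulr_ge0//.
  rewrite real_normK ?num_real// exprMn sin2cos2; apply/eqP.
  by move: rho2; rewrite {1}pE; lra.
have [q0|q0] := leP 0 q.
  exists rho, th, 1; split => //; first by left.
  by rewrite !mul1r -pE -qE ger0_norm.
exists rho, th, (-1); split => //; first by right.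
by rewrite !mulN1r cosN sinN mulrN -pE -qE ltr0_norm// opprK.
Qed.

(** If [th > pi / r], rotating by [2 pi / r] towards the positive real axis leaves the angle
    [|th - 2 pi / r| < th] and increases the real part. *)
Lemma Crot_maximal_sector r z : (0 < r)%N ->
  (forall w, Crot r w -> complex.Re (w * z) <= complex.Re z) ->
  exists rho th, [/\ 0 <= rho, 0 <= th <= pi / r%:R,
    complex.Re z = rho * cos th,
    complex.Re z ^+ 2 + complex.Im z ^+ 2 = rho ^+ 2 &
    complex.Re (z ^+ r) = rho ^+ r * cos (r%:R * th)].
Proof.
move=> r0 zmax; have [rho [th [e [rho0 th0 th1 eE zE]]]] := polar_decomposition z.
have cosE x : cos (e * x) = cos x by case: eE => ->; rewrite ?mul1r// mulN1r cosN.
have p0 := pi_gt0 R; have rp : 0 < r%:R :> R by rewrite ltr0n.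
have reim : complex.Re z ^+ 2 + complex.Im z ^+ 2 = rho ^+ 2.
  by rewrite zE /= !exprMn -mulrDr cos2Dsin2 mulr1.
have [rhoz|rhon0] := eqVneq rho 0.
  (* For [z = 0] maximality does not constrain the angle, so 0 is chosen. *)
  exists 0, 0; split=> //; rewrite ?lexx ?divr_ge0 ?ltW//.
  - by rewrite zE rhoz /= !mul0r.
  - by rewrite reim rhoz.
  - by rewrite zE polarX rhoz /= expr0n gtn_eqF//= !mul0r.
have rhop : 0 < rho by rewrite lt_neqAle eq_sym rhon0.
exists rho, th; split=> //; last 1 first.
- by rewrite zE polarX /= (mulrCA _ e) cosE.
- rewrite th0 /= leNgt; apply/negP => thr.
  pose a : R := 2 * pi / r%:R.
  have ha : a = 2 * (pi / r%:R) by rewrite /a mulrA.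
  have ap : 0 < pi / r%:R :> R by rewrite divr_gt0.
  (* Rotation by [- e a]: this is [zeta^-1] for [e = 1] and [zeta] for [e = -1]. *)
  pose w : R[i] := (cos a +i* - (e * sin a))%C.
  have wC : Crot r w.
    case: eE => eE; rewrite /w eE ?mul1r ?mulN1r ?opprK.
      exists (-1); rewrite -[LHS]mul1r.
      rewrite -[X in X * _ = _](mulVf (zeta_neq0 R r)) -mulrA.
      by rewrite -[X in _ * (X)]/(zeta R r * (zeta R r)^*%C) zeta_conj mulr1 exprN1.
    by exists 1; rewrite expr1z.
  have := zmax w wC; rewrite zE /= cosE.
  have -> : sin (e * th) = e * sin th.
    by case: eE => ->; rewrite ?mul1r// !mulN1r sinN.
  have -> : cos a * (rho * cos th) - - (e * sin a) * (rho * (e * sin th))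
      = rho * (cos th * cos a + (e * e) * (sin th * sin a)) by ring.
  have -> : e * e = 1 by case: eE => ->; ring.
  rewrite mul1r -cosB ler_pM2l//; apply/negP; rewrite -ltNge.
  have [x0|x0] := leP 0 (th - a).
    by rewrite ltr_cos ?in_itv /=; [lra|lra|lra].
  by rewrite -[cos (th - a)]cosN opprB ltr_cos ?in_itv /=; [lra|lra|lra].
by rewrite zE /= cosE.
Qed.
End RootSector.

(** * The Hermitian product and the Cauchy-Schwarz inequality *)

Section ComplexInner.
Variables (R : realType) (I : finType).
Implicit Types (u v : Cspace R I) (z : R[i]).

Lemma cdot_scalel z u v : cdot (cscale z u) v = z * cdot u v.
Proof. by rewrite /cdot mulr_sumr; apply: eq_bigr => i _; rewrite ffunE mulrA. Qed.

Lemma cdot_scaler z u v : cdot u (cscale z v) = z^*%C * cdot u v.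
Proof.
rewrite /cdot mulr_sumr; apply: eq_bigr => i _.
by rewrite ffunE rmorphM /= mulrCA.
Qed.

Lemma cdot_norm u : cdot u u = (`|u| ^+ 2)%:C%C.
Proof.
rewrite -inner_norm Cspace_innerE; apply/eqP; rewrite eq_complex eqxx /=.
apply/eqP; rewrite /cdot; elim/big_rec: _ => // i x _.
by case: (u i) x => [a b] [c d] /= ->; ring.
Qed.

Lemma norm_cscale z u :
  `|cscale z u| ^+ 2 = (complex.Re z ^+ 2 + complex.Im z ^+ 2) * `|u| ^+ 2.
Proof.
rewrite -(inner_norm (cscale z u)) Cspace_innerE cdot_scalel cdot_scaler cdot_norm.
by case: z => p q /=; ring.
Qed.

Lemma inner_le_norm u v : inner u v <= `|u| * `|v|.
Proof.
have [->|u0] := eqVneq u 0; first by rewrite inner0l normr0 mul0r.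
have [->|v0] := eqVneq v 0; first by rewrite innerC inner0l normr0 mulr0.
have uv0 : 0 < `|u| * `|v| by rewrite mulr_gt0// normr_gt0.
rewrite -(ler_pM2l uv0).
have := sqr_ge0 `| `|v| *: u - `|u| *: v|.
rewrite normB_sqr !normrZ !normr_id innerZl innerZr; lra.
Qed.

(** Complex Cauchy-Schwarz from the real one: scaling [v] by [cdot u v] makes its product with [u]
    equal to [rho^2]. *)
Lemma cdot_le_norm u v rho : 0 <= rho ->
  complex.Re (cdot u v) ^+ 2 + complex.Im (cdot u v) ^+ 2 = rho ^+ 2 ->
  rho <= `|u| * `|v|.
Proof.
move=> rho0 rhoE; have [->|rn0] := eqVneq rho 0; first by rewrite mulr_ge0.
have rp : 0 < rho by rewrite lt_neqAle eq_sym rn0.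
have nv : `|cscale (cdot u v) v| = rho * `|v|.
  by apply/eqP; rewrite -(@eqrXn2 _ 2) ?mulr_ge0// norm_cscale rhoE exprMn.
have := inner_le_norm u (cscale (cdot u v) v).
rewrite nv Cspace_innerE cdot_scaler.
have -> : complex.Re ((cdot u v)^*%C * cdot u v) = rho * rho.
  by rewrite -expr2 -rhoE; case: (cdot u v) => p q /=; ring.
by rewrite mulrCA ler_pM2l.
Qed.

Lemma cdot0l v : cdot 0 v = 0 :> R[i].
Proof. by rewrite /cdot big1// => i _; rewrite ffunE mul0r. Qed.

Lemma cdot0r u : cdot u 0 = 0 :> R[i].
Proof. by rewrite /cdot big1// => i _; rewrite ffunE rmorph0 mulr0. Qed.
End ComplexInner.

(** * Inner products of the tensor maps *)

Section EmbeddingInner.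
Variables (R : realType) (n : nat).
Implicit Types u v : Cspace R 'I_n.

Lemma cdot_conj_vec u v : cdot (conj_vec u) (conj_vec v) = (cdot u v)^*%C.
Proof.
by rewrite /cdot rmorph_sum; apply: eq_bigr => i _; rewrite !ffunE rmorphM.
Qed.

(** The second tensor factor contributes the conjugate of [cdot u v]. Since [0^-1 = 0], the formula
    covers zero vectors too. *)
Lemma inner_phi u v : inner (phi u) (phi v) =
  (`|u| * `|v|)^-1 * (complex.Re (cdot u v) ^+ 2 + complex.Im (cdot u v) ^+ 2).
Proof.
rewrite /phi; have [->|u0] := eqVneq u 0; first by rewrite inner0l normr0 mul0r invr0 mul0r.
have [->|v0] := eqVneq v 0; first by rewrite innerC inner0l normr0 mulr0 invr0 mul0r.
rewrite innerZl innerZr mulrA -invfM Cspace_innerE cdot_pure_tensor.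
rewrite !big_ord_recl big_ord0 /= cdot_conj_vec mulr1.
by congr (_ * _); case: (cdot u v) => p q /=; ring.
Qed.

Lemma inner_psi r u v : (0 < r)%N -> inner (psi r u) (psi r v) =
  ((`|u| * `|v|) ^+ r.-1)^-1 * complex.Re (cdot u v ^+ r).
Proof.
move=> r0; rewrite /psi; have [->|u0] := eqVneq u 0.
  by rewrite inner0l cdot0l expr0n gtn_eqF//= mulr0.
have [->|v0] := eqVneq v 0.
  by rewrite innerC inner0l cdot0r expr0n gtn_eqF//= mulr0.
rewrite innerZl innerZr mulrA -invfM -exprMn Cspace_innerE cdot_pure_tensor.
by rewrite prodr_const card_ord.
Qed.

Lemma norm_phi u : `|phi u| ^+ 2 = `|u| ^+ 2.
Proof.
rewrite -inner_norm inner_phi cdot_norm /= expr0n addr0.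
have [->|u0] := eqVneq `|u| 0; first by rewrite !mul0r invr0 mul0r expr0n.
by field.
Qed.

Lemma norm_psi r u : (0 < r)%N -> `|psi r u| ^+ 2 = `|u| ^+ 2.
Proof.
case: r => // r _; rewrite -inner_norm inner_psi// cdot_norm -rmorphXn /=.
have [->|u0] := eqVneq `|u| 0.
  by rewrite (expr0n _ 2) /= expr0n mulr0.
by rewrite exprSr -expr2 mulKf// expf_neq0// expf_neq0.
Qed.
End EmbeddingInner.

Section FmapBounds.
Variables (R : realType) (r n : nat).
Hypothesis r2 : (2 <= r)%N.
Implicit Types u v : Cspace R 'I_n.

Let r0 : (0 < r)%N. Proof. exact: ltnW. Qed.

Lemma FmapB_norm u v :
  let t := pi / (2 * r%:R) in
  `|Fmap (orbit_class r u) - Fmap (orbit_class r v)| ^+ 2 =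
  `|u| ^+ 2 + `|v| ^+ 2
  - 2 * (cos t ^+ 2 * inner (phi u) (phi v) + sin t ^+ 2 * inner (psi r u) (psi r v)).
Proof.
move=> t; rewrite hilbert_prod_normE !Fmap_orbit /= !normB_sqr.
rewrite !innerZl !innerZr !normrZ !exprMn !real_normK ?num_real//.
rewrite !norm_phi !norm_psi// -/t (mulrA (sin t)) -expr2 sin2cos2; ring.
Qed.

Lemma Fmap_bounds u v :
  mdist (orbit_class r u) (orbit_class r v)
    <= `|Fmap (orbit_class r u) - Fmap (orbit_class r v)|
  /\ `|Fmap (orbit_class r u) - Fmap (orbit_class r v)|
    <= r%:R * sin (pi / (2 * r%:R)) * mdist (orbit_class r u) (orbit_class r v).
Proof.
have rs0 : 0 <= r%:R * sin (pi / (2 * r%:R)) :> R.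
  by rewrite mulr_ge0// ltW// sin_half_angle_gt0.
have [w wC dE] := rot_dist_attained r u v.
have vE : orbit_class r v = orbit_class r (cscale w v).
  by apply/esym/orbit_eqP; exists w.
have vmin z : Crot r z -> `|u - cscale w v| <= `|u - cscale z (cscale w v)|.
  by move=> zC; rewrite -dE cscaleA; apply: rot_dist_le; exact: CrotM.
rewrite mdist_orbit -/(rot_dist r u v) dE vE.
move: (cscale w v) vmin => {vE w wC dE} {}v vmin.
(* Now [v] is the point of its orbit nearest to [u]. As rotations preserve norms, this means that
   they cannot increase the real part of [cdot u v]. *)
have [|rho [th [rho0 /andP[th0 th1] reE absE powE]]] := @Crot_maximal_sector R r (cdot u v) r0.
  move=> w wC; have wV : Crot r w^-1 by exact: CrotV.
  have := vmin _ wV; rewrite -ler_sqr ?nnegrE// !normB_sqr (norm_cscale_Crot _ wV).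
  rewrite !Cspace_innerE cdot_scaler.
  have -> : (w^-1)^*%C = w.
    by rewrite -[LHS](mulKf (Crot_neq0 wV)) (Crot_conj wV) mulr1 invrK.
  lra.
have rho_le := cdot_le_norm rho0 absE.
pose m := `|u| * `|v|; have m0 : 0 <= m by rewrite mulr_ge0.
(* For [m = 0] this gives [x = 0], while Cauchy-Schwarz gives [rho = 0]; so [rho = m x] always
   holds. *)
pose x := rho / m.
have rhoE : rho = m * x.
  have [mz|mn0] := eqVneq m 0; last by rewrite mulrC divfK.
  by apply/le_anti; rewrite mz mul0r rho0 -[in leRHS]mz rho_le.
have x0 : 0 <= x by rewrite divr_ge0.
have x1 : x <= 1.
  have [mz|mn0] := eqVneq m 0; first by rewrite /x mz invr0 mulr0.
  by rewrite ler_pdivrMr ?mul1r// lt_neqAle eq_sym mn0.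
have := embedding_bounds r2 (normr_ge0 u) (normr_ge0 v) x0 x1 th0 th1.
have <- : `|u - v| ^+ 2 = `|u| ^+ 2 + `|v| ^+ 2 - 2 * (`|u| * `|v| * (x * cos th)).
  by rewrite normB_sqr Cspace_innerE reE {1}rhoE -[in LHS]mulrA.
have <- : `|Fmap (orbit_class r u) - Fmap (orbit_class r v)| ^+ 2 =
  `|u| ^+ 2 + `|v| ^+ 2 - 2 * (`|u| * `|v| * (cos (pi / (2 * r%:R)) ^+ 2 * x ^+ 2
     + sin (pi / (2 * r%:R)) ^+ 2 * (x ^+ r * cos (r%:R * th)))).
  rewrite FmapB_norm inner_phi inner_psi// absE powE -/m.
  have [mz|mn0] := eqVneq m 0.
    have -> : rho = 0 by rewrite rhoE mz mul0r.
    by rewrite mz [0 ^+ r]expr0n gtn_eqF// invr0 !(mul0r, mulr0, addr0).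
  have -> : m^-1 * rho ^+ 2 = m * x ^+ 2 by rewrite rhoE; field.
  have -> : (m ^+ r.-1)^-1 * (rho ^+ r * cos (r%:R * th)) = m * (x ^+ r * cos (r%:R * th)).
    rewrite rhoE [(m * x) ^+ r]exprMn (_ : m ^+ r = m ^+ r.-1 * m); last by rewrite -exprSr prednK.
    by rewrite -!mulrA mulKf// expf_neq0.
  by ring.
move=> /= [lo up]; split.
  by rewrite -ler_sqr ?nnegrE.
by rewrite -ler_sqr ?nnegrE ?(mulr_ge0 rs0)// exprMn.
Qed.
End FmapBounds.

(** * Optimality *)

Section CircleEmbeddings.
Variables (R : realType) (r n : nat).
Hypotheses (r2 : (2 <= r)%N) (n1 : (1 <= n)%N).
Implicit Types x y : R.

Let r0 : (0 < r)%N. Proof. exact: ltnW. Qed.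
Let rR0 : 0 < r%:R :> R. Proof. by rewrite ltr0n. Qed.

Let e : Cspace R 'I_n := [ffun i => (i == Ordinal n1)%:R].

Let cis x : R[i] := (cos x +i* sin x)%C.

Let cisD x y : cis (x + y) = cis x * cis y.
Proof.
rewrite /cis cosD sinD; apply/eqP; rewrite eq_complex /= eqxx /=.
by rewrite [X in X == _]addrC.
Qed.

Let norm_e : `|e| = 1.
Proof.
apply/eqP; rewrite -(@eqrXn2 _ 2)// Cspace_normE (bigD1 (Ordinal n1))//= big1.
  by rewrite ffunE eqxx /= !expr1n expr0n !addr0.
by move=> i /negbTE h; rewrite ffunE h /= expr0n addr0.
Qed.

Let dist_cis x y : `|cscale (cis x) e - cscale (cis y) e| ^+ 2 = 2 - 2 * cos (x - y).
Proof.
rewrite normB_sqr !norm_cscale norm_e Cspace_innerE cdot_scalel cdot_scaler.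
rewrite cdot_norm norm_e /= cosB !cos2Dsin2 expr1n; ring.
Qed.

Definition circle_point x : orbit_space R n r := orbit_class r (cscale (cis x) e).

Lemma circle_point_periodic x : circle_point (x + 2 * pi / r%:R) = circle_point x.
Proof.
apply/orbit_eqP; exists (zeta R r); first by exists 1; rewrite expr1z.
by rewrite cscaleA addrC cisD.
Qed.

(** The rotation 1 already yields the chord between the two representatives. *)
Lemma circle_point_dist_le x y :
  mdist (circle_point x) (circle_point y) ^+ 2 <= 2 - 2 * cos (x - y).
Proof.
rewrite mdist_orbit -/(rot_dist r _ _) -dist_cis.
have h := rot_dist_le (cscale (cis x) e) (cscale (cis y) e) (Crot1 R r).
rewrite cscale1 in h; apply: lerXn2r h; rewrite nnegrE//.
by have [z _ ->] := rot_dist_attained r (cscale (cis x) e) (cscale (cis y) e).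
Qed.

Let cos_away a y : 0 <= a -> a <= y -> y <= 2 * pi - a -> cos y <= cos a.
Proof.
move=> a0 ay ya; have [yp|py] := leP y pi.
  by rewrite leNgt ltr_cos ?in_itv /=; [rewrite -leNgt|lra|lra].
have -> : cos y = cos (2 * pi - y).
  by rewrite mulr_natl cosB cos2pi sin2pi; ring.
by rewrite leNgt ltr_cos ?in_itv /=; [rewrite -leNgt; lra|lra|lra].
Qed.

(** The angles between the two orbits are odd multiples of [pi / r], hence at least [pi / r] modulo
    [2 pi], and the chord of [pi / r] is [2 sin (pi / (2r))]. *)
Lemma circle_point_antipodal_ge x :
  (2 * sin (pi / (2 * r%:R))) ^+ 2
    <= mdist (circle_point (x + pi / r%:R)) (circle_point x) ^+ 2.
Proof.
rewrite mdist_orbit -/(rot_dist r _ _).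
have [z /Crot_finite[k ->] ->] :=
  rot_dist_attained r (cscale (cis (x + pi / r%:R)) e) (cscale (cis x) e).
rewrite cscaleA zetaX -/(cis _) -cisD dist_cis.
set p := pi / r%:R; have p0 : 0 < p by rewrite divr_gt0 ?pi_gt0.
have rp : r%:R * p = pi by rewrite /p mulrC divfK// gt_eqF.
have -> : 2 * pi / r%:R *+ k = k%:R * (2 * p) by rewrite /p -mulr_natl; ring.
have -> : x + p - (k%:R * (2 * p) + x) = p - k%:R * (2 * p) by ring.
have -> : (2 * sin (pi / (2 * r%:R))) ^+ 2 = 2 - 2 * cos p.
  have -> : p = pi / (2 * r%:R) *+ 2 by rewrite mulr2n /p; field; rewrite gt_eqF.
  by rewrite mulr2n cosD -!expr2 exprMn cos2sin2; ring.
suff : cos (p - k%:R * (2 * p)) <= cos p by lra.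
have kr : (k < r)%N by rewrite -[r in X in (_ < X)%N]prednK.
case: (nat_of_ord k) kr => [|j] jr; first by rewrite mul0r subr0.
rewrite -cosN opprB -natr1; have j0 : 0 <= j%:R :> R by [].
have jr' : j%:R + 2 <= r%:R :> R by rewrite -natrD ler_nat addn2.
apply: cos_away; [exact: ltW| |].
  by have := mulr_ge0 j0 (ltW p0); lra.
by have := ler_wpM2r (ltW p0) jr'; rewrite rp; lra.
Qed.

Variable H : hilbertType R.
Implicit Types (f : orbit_space R n r -> H).

Lemma lipschitz_ratio_dyadic f (alpha beta : R) i : 0 <= alpha -> 0 <= beta ->
  (forall p q, alpha * mdist p q <= mdist (f p) (f q)) ->
  (forall p q, mdist (f p) (f q) <= beta * mdist p q) ->
  alpha * (r%:R * sin (pi / (2 * r%:R))) * cos (pi / 2 ^+ i.+2) <= beta.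
Proof.
move=> a0 b0 lo up; pose N := (2 ^ i.+1)%N.
have N0 : 0 < N%:R :> R by rewrite ltr0n expn_gt0.
have N2 : 2 <= N%:R :> R by rewrite ler_nat -[leqLHS]expn1 leq_exp2l.
(* Half the angular step: [2N] steps of [2 h] cover the period [2 pi / r] of [circle_point], and [N]
   steps lead to the antipode. *)
pose h : R := pi / (2 * (r%:R * N%:R)).
have hp : 0 < h by rewrite divr_gt0 ?pi_gt0// !mulr_gt0.
have rh : r%:R * h = pi / (2 * N%:R) by rewrite /h; field; rewrite !gt_eqF.
have Nh : N%:R * (2 * h) = pi / r%:R by rewrite /h; field; rewrite !gt_eqF.
have rh4 : r%:R * h <= pi / 4.
  by rewrite rh ler_pM2l ?pi_gt0// lef_pV2 ?posrE//; lra.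
have hle : h <= pi / 4 by apply: le_trans rh4; apply: ler_peMl; [exact: ltW|rewrite ler1n].
pose F (j : nat) := f (circle_point (j%:R * (2 * h))).
have FS j d : F (j + d)%N = f (circle_point (j%:R * (2 * h) + d%:R * (2 * h))).
  by rewrite /F natrD mulrDl.
have Fper j : F (j + 2 * N)%N = F j.
  by rewrite FS natrM -(mulrA 2) Nh (mulrA 2) circle_point_periodic.
have sh : 0 < sin h by apply: sin_gt0_pi; have := pi_gt0 R; lra.
set s := sin (pi / (2 * r%:R)).
have s0 : 0 < s by exact: sin_half_angle_gt0.
have farF (j : 'I_(2 * N)) : (alpha * (2 * s)) ^+ 2 <= `|F (j + N)%N - F j| ^+ 2.
  rewrite FS Nh -mdist_normB.
  apply: le_trans (_ : (alpha * mdist (circle_point (j%:R * (2 * h) + pi / r%:R))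
      (circle_point (j%:R * (2 * h)))) ^+ 2 <= _).
    by rewrite !exprMn -exprMn ler_wpM2l ?sqr_ge0// circle_point_antipodal_ge.
  by apply: lerXn2r; rewrite ?nnegrE ?mulr_ge0// ?mdist_ge0.
have nearF (j : 'I_(2 * N)) : `|F (j + 1)%N - F j| ^+ 2 <= (beta * (2 * sin h)) ^+ 2.
  rewrite FS -mdist_normB.
  apply: le_trans (_ : (beta * mdist (circle_point (j%:R * (2 * h) + 1%:R * (2 * h)))
      (circle_point (j%:R * (2 * h)))) ^+ 2 <= _).
    by apply: lerXn2r; rewrite ?nnegrE ?mulr_ge0 ?mdist_ge0//; exact: up.
  rewrite !exprMn ler_wpM2l ?sqr_ge0//.
  apply: le_trans (circle_point_dist_le _ _) _.
  rewrite [X in cos X](_ : _ = h *+ 2); last by ring.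
  by rewrite mulr2n cosD -!expr2 cos2sin2; lra.
have NN : 0 < (2 * N)%:R :> R by rewrite ltr0n muln_gt0 expn_gt0.
have := @cyclic_poincare R H F i N erefl Fper.
rewrite -rh => P.
have {farF nearF}P : sin (r%:R * h) * (alpha * (2 * s)) <= beta * (2 * sin h).
  have srh : 0 <= sin (r%:R * h).
    by apply: sin_ge0_quarter; [rewrite mulr_ge0 ?ltW|have := pi_gt0 R; lra].
  have L0 : 0 <= sin (r%:R * h) * (alpha * (2 * s)).
    by rewrite !mulr_ge0// ltW.
  have R0 : 0 <= beta * (2 * sin h) by rewrite !mulr_ge0// ltW.
  rewrite -ler_sqr ?nnegrE// -(ler_pM2l NN) [X in _ * X <= _]exprMn.
  have A : \sum_(j < 2 * N) (alpha * (2 * s)) ^+ 2 <= \sum_(j < 2 * N) `|F (j + N)%N - F j| ^+ 2.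
    exact: ler_sum.
  have B : \sum_(j < 2 * N) `|F (j + 1)%N - F j| ^+ 2 <= \sum_(j < 2 * N) (beta * (2 * sin h)) ^+ 2.
    exact: ler_sum.
  have SC (x : R) : \sum_(j < 2 * N) x = (2 * N)%:R * x.
    by rewrite sumr_const card_ord mulr_natl.
  rewrite !{}SC in A B.
  have A' := ler_wpM2l (sqr_ge0 (sin (r%:R * h))) A.
  by rewrite mulrCA; apply: le_trans A' _; exact: le_trans P B.
(* Bounding [sin (r h) / sin h] below by [r cos (r h)] leaves only a cosine for the limit. *)
have T : r%:R * sin h * cos (r%:R * h) <= sin (r%:R * h).
  apply: le_trans (tan_natmul_ge (ltW hp) _) _; first by have := pi_gt0 R; lra.
  rewrite ler_piMr ?cos_le1//.
  by apply: sin_ge0_quarter; [rewrite mulr_ge0 ?ltW|have := pi_gt0 R; lra].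
have -> : pi / 2 ^+ i.+2 = r%:R * h.
  by rewrite rh /N natrX -exprS.
rewrite -(ler_pM2r sh).
have := ler_wpM2l (mulr_ge0 a0 (ltW s0)) T; lra.
Qed.

Lemma lipschitz_ratio f (alpha beta : R) : 0 <= alpha -> 0 <= beta ->
  (forall p q, alpha * mdist p q <= mdist (f p) (f q)) ->
  (forall p q, mdist (f p) (f q) <= beta * mdist p q) ->
  alpha * (r%:R * sin (pi / (2 * r%:R))) <= beta.
Proof.
move=> a0 b0 lo up; set A := _ * (_ * _).
have ang : ((pi / 2 ^+ i.+2 : R) @[i --> \oo] --> (0 : R))%classic.
  have : `|2^-1 : R| < 1 by rewrite ger0_norm//; lra.
  (* The angles form the geometric sequence [(pi / 4) 2^(-i)]. *)
  move=> /(@cvg_geometric R (pi / 4)); apply: cvg_trans.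
  apply: near_eq_cvg; near=> i; rewrite /geometric /= -exprVn !exprS exprVn; field.
  by rewrite expf_neq0.
have lim : ((A * cos (pi / 2 ^+ i.+2)) @[i --> \oo] --> (A : R))%classic.
  have := cvg_comp _ _ ang (@continuous_cos R 0); rewrite cos0 => cos_lim.
  by rewrite -[X in (_ --> X)%classic]mulr1; apply: cvgM => //; exact: cvg_cst.
apply: (cvgr_to_le lim); near=> i.
exact: lipschitz_ratio_dyadic lo up.
Unshelve. all: by end_near. Qed.

Lemma distortion_ge f :
  ((r%:R * sin (pi / (2 * r%:R)))%:E <= distortion f)%E.
Proof.
rewrite /distortion; case: ifPn => [_|]; first exact: leey.
rewrite negb_or => /andP[l0 uy].
have lo := lower_lipP f; have up := upper_lipP f.
have lge : (0 <= lower_lip f)%E.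
  apply: ereal_sup_ubound; split=> // p q.
  by rewrite mul0e lee_fin mdist_ge0.
have uge : (0 <= upper_lip f)%E by apply: le_ereal_inf_tmp => b [].
(* Two distinct orbits, whose finite image distance excludes an infinite lower constant. *)
have d0 : 0 < mdist (circle_point (0 + pi / r%:R)) (circle_point 0).
  rewrite lt_neqAle mdist_ge0 andbT eq_sym; apply/eqP => dE.
  have := circle_point_antipodal_ge 0; rewrite dE expr0n /=; apply/negP.
  by rewrite -ltNge exprn_gt0// mulr_gt0// sin_half_angle_gt0.
move: l0 uy lge uge lo up; case: (lower_lip f) => [a| |]//; last first.
  move=> _ _ _ _ lo; have := lo (circle_point (0 + pi / r%:R)) (circle_point 0).
  by rewrite gt0_mulye.
case: (upper_lip f) => [b| |]// l0 _ age bge lo up.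
rewrite !lee_fin in age bge; have an0 : a != 0 by rewrite -eqe.
have ap : 0 < a by rewrite lt_neqAle eq_sym an0.
rewrite inver (negbTE an0) lee_pdivlMr// -EFinM lee_fin mulrC.
by apply: (@lipschitz_ratio f) => // p q; rewrite -lee_fin EFinM.
Qed.
End CircleEmbeddings.

Theorem theorem16 (R : realType) (r n : nat) (hr : (2 <= r)%N) (hn : (1 <= n)%N) :
  (forall u v : Cspace R 'I_n,
      mdist (orbit_class r u) (orbit_class r v)
        <= `|Fmap (orbit_class r u) - Fmap (orbit_class r v)|
   /\ `|Fmap (orbit_class r u) - Fmap (orbit_class r v)|
        <= r%:R * sin (pi / (2 * r%:R))
             * mdist (orbit_class r u) (orbit_class r v))
  /\ euclidean_distortion (orbit_space R n r) = distortion (@Fmap R n r)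
  /\ distortion (@Fmap R n r) = (r%:R * sin (pi / (2 * r%:R)))%:E.
Proof.
have bounds := @Fmap_bounds R r n hr.
split; first exact: bounds.
have ge (H : hilbertType R) (f : orbit_space R n r -> H) :
    ((r%:R * sin (pi / (2 * r%:R)))%:E <= distortion f)%E.
  exact: distortion_ge.
(* With [ge] for all maps, this bound makes [Fmap] attain the infimum and fixes its distortion. *)
suff le : (distortion (@Fmap R n r) <= (r%:R * sin (pi / (2 * r%:R)))%:E)%E.
  have dE := le_anti (introT andP (conj le (ge _ (@Fmap R n r)))).
  split; last exact: dE.
  apply: le_anti; apply/andP; split.
    by apply: ereal_inf_lbound; exists (hilbert_prod (tensor_power R n 2) (tensor_power R n r)), (@Fmap R n r).
  by rewrite dE; apply: le_ereal_inf_tmp => _ [H [f <-]]; exact: ge.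
have {}bounds p q : mdist p q <= mdist (@Fmap R n r p) (Fmap q) /\
    mdist (@Fmap R n r p) (Fmap q) <= r%:R * sin (pi / (2 * r%:R)) * mdist p q.
  rewrite mdist_normB -[p]reprK -[q]reprK; exact: bounds.
have lge : (1 <= lower_lip (@Fmap R n r))%E.
  apply: ereal_sup_ubound; split=> // p q; rewrite mul1e lee_fin.
  exact: (bounds p q).1.
have rs0 : 0 <= r%:R * sin (pi / (2 * r%:R)) :> R.
  by rewrite mulr_ge0// ltW// sin_half_angle_gt0.
have ule : (upper_lip (@Fmap R n r) <= (r%:R * sin (pi / (2 * r%:R)))%:E)%E.
  apply: ereal_inf_lbound; split=> [|p q]; first by rewrite lee_fin.
  by rewrite -EFinM lee_fin; exact: (bounds p q).2.
have uge : (0 <= upper_lip (@Fmap R n r))%E by apply: le_ereal_inf_tmp => b [].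
rewrite /distortion ifF; last first.
  by apply/negbTE; rewrite negb_or gt_eqF ?(lt_le_trans _ lge)//= lt_eqF ?(le_lt_trans ule) ?ltry.
(* An infinite lower constant would make the quotient 0, so that [rs0] suffices in that case. *)
move: lge ule uge; case: (lower_lip _) => [a| |]//; last first.
  by move=> _ _ _; rewrite invey mule0 lee_fin.
case: (upper_lip _) => [b| |]//; rewrite !lee_fin => a1 bs b0.
have ap : 0 < a by apply: lt_le_trans a1.
rewrite inver gt_eqF// lee_fin ler_pdivrMr//; apply: le_trans bs _.
by rewrite ler_peMr.
Qed.
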